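(* Let $\Gamma$ be a discrete amenable group, let $n\ge1$ be an integer, and let $f\colon\Gamma\to\mathrm{Sym}(n)$ be a function. Then there are an integer $N$ and a group homomorphism $h\colon\Gamma\to\mathrm{Sym}(N)$ such that $d_\infty(h,f)\le 2039\,\mathrm{def}_\infty(f)$ and $n\le N\le(1+1218\,\mathrm{def}_\infty(f))\,n$.
   Context: Write $[n]=\{1,\dots,n\}$. For integers $1\le n\le N$, $\sigma\in\mathrm{Sym}(n)$ and $\tau\in\mathrm{Sym}(N)$, put $d^H(\sigma,\tau)=d^H(\tau,\sigma)=\frac1N\left(|\{x\in[n] : \sigma(x)\ne\tau(x)\}|+(N-n)\right)$ (for $N=n$ this is the normalized Hamming distance). For functions $f\colon\Gamma\to\mathrm{Sym}(n)$ and $h\colon\Gamma\to\mathrm{Sym}(N)$: $\mathrm{def}_\infty(f)=\sup\{d^H(f(\gamma_1\gamma_2),f(\gamma_1)f(\gamma_2)) : \gamma_1,\gamma_2\in\Gamma\}$ and $d_\infty(f,h)=d_\infty(h,f)=\sup\{d^H(f(\gamma),h(\gamma)) : \gamma\in\Gamma\}$. A discrete group $\Gamma$ is amenable if it admits a left-invariant finitely additive probability measure defined on all subsets of $\Gamma$. *)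

(* Defs.v *)
From mathcomp Require Import all_boot all_order all_algebra all_fingroup.
From mathcomp Require Import all_classical all_reals.

Set Implicit Arguments.
Unset Strict Implicit.
Unset Printing Implicit Defensive.

Import Order.TTheory GRing.Theory Num.Theory.
Local Open Scope classical_set_scope.
Local Open Scope ring_scope.

Definition amenable (R : realType) (Gamma : groupType) : Prop :=
  exists mu : set Gamma -> R,
    [/\ forall A, 0 <= mu A,
        mu [set: Gamma] = 1,
        forall A B, A `&` B = set0 -> mu (A `|` B) = mu A + mu B
      & forall (g : Gamma) A, mu [set (g * x)%g | x in A] = mu A].

(* The product of permutations x |-> s (t x). The product of 'S_n composes
   from left to right, (s * t) x = t (s x), hence the swap. *)
Definition perm_comp (n : nat) (s t : 'S_n) : 'S_n := (t * s)%g.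

(* Symmetric notation on paper; the permutation of the smaller set always
   comes first here, and 'I_n is viewed inside 'I_N through widen_ord. *)
Definition dH (R : realType) (n N : nat) (le_nN : (n <= N)%N)
    (s : 'S_n) (t : 'S_N) : R :=
  (#|[set x : 'I_n | widen_ord le_nN (s x) != t (widen_ord le_nN x)]%SET|
     + (N - n))%N%:R / N%:R.

(* The suprema below are over nonempty subsets of [0, 1], so the real sup is
   the true least upper bound. *)
Definition def_infty (R : realType) (Gamma : groupType) (n : nat)
    (f : Gamma -> 'S_n) : R :=
  sup [set r | exists g1 g2 : Gamma,
         r = dH R (leqnn n) (f (g1 * g2)%g) (perm_comp (f g1) (f g2))].

Definition d_infty (R : realType) (Gamma : groupType) (n N : nat)
    (le_nN : (n <= N)%N) (f : Gamma -> 'S_n) (h : Gamma -> 'S_N) : R :=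
  sup [set r | exists g : Gamma, r = dH R le_nN (f g) (h g)].

Definition perm_hom (Gamma : groupType) (N : nat) (h : Gamma -> 'S_N) : Prop :=
  {morph h : g1 g2 / (g1 * g2)%g >-> perm_comp g1 g2}.

(* Main.v *)
Require Import Defs.
From mathcomp Require Import all_boot all_order all_algebra all_fingroup.
From mathcomp Require Import all_classical all_reals.
From mathcomp Require Import lra.

(* Let c = def(f) n. Gamma acts by left translation on the functions
   Gamma -> [n], and this action is isometric for the Hamming distance given by
   the invariant mean. The functions F_i : x |-> f(x^-1)(i) are at distance 1
   from each other, and for each g the distances from g F_i to F_(f(g)(i)) add
   up to at most c. Call a function near if it is within 1/6 of some F_k, and
   keep the translates of those F_i for which most translates of F_i are near,
   which is all but 12c of the indices. On these, being at distance < 1/3 is an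
   equivalence relation, since distances below 2/3 are below 1/3: some g moves
   both functions near F_k and F_l with d(F_k, F_l) < 1, so k = l. The quotient
   is a finite Gamma-set with at most n + 48c points; adding one fixed point for
   each discarded i gives h, which differs from f in at most 27c points. *)

Import Order.TTheory GRing.Theory Num.Theory.
Local Open Scope ring_scope.

Set Implicit Arguments.
Unset Strict Implicit.
Unset Printing Implicit Defensive.

(** * Averaging against a finitely additive probability measure *)

Section FinitelyAdditiveProbability.
Local Open Scope classical_set_scope.
Context (R : realType) (T : Type) (mu : set T -> R).
Hypothesis mu_ge0 : forall A, 0 <= mu A.
Hypothesis mu_setT : mu [set: T] = 1.
Hypothesis muU : forall A B, A `&` B = set0 -> mu (A `|` B) = mu A + mu B.

Let pr (P : pred T) := mu [set t | P t].

Lemma mu_split (A B : set T) : mu B = mu (B `&` A) + mu (B `\` A).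
Proof. by rewrite -muU ?setUIDK// -setIA setDIK setI0. Qed.

Lemma mu_set0 : mu set0 = 0.
Proof. by have := muU (setI0 set0); rewrite setU0; lra. Qed.

Lemma mu_mono (A B : set T) : A `<=` B -> mu A <= mu B.
Proof. by move=> AB; rewrite (mu_split A B) setIidr// lerDl. Qed.

Lemma pr_full (P : pred T) : (forall t, P t) -> pr P = 1.
Proof.
move=> allP; rewrite -mu_setT; congr mu; apply: eq_set => t.
by rewrite allP propeqE.
Qed.

Lemma pr_empty (P : pred T) : (forall t, ~~ P t) -> pr P = 0.
Proof.
move=> noP; rewrite -mu_set0; congr mu; rewrite predeqE => t; split=> //= Pt.
by have := noP t; rewrite Pt.
Qed.

Lemma pr_sub (P Q S : pred T) :
  (forall t, P t -> Q t || S t) -> pr P <= pr Q + pr S.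
Proof.
move=> PQS; rewrite /pr (mu_split [set t | Q t] [set t | P t]).
apply: lerD; apply: mu_mono => t /=; first by case.
by case=> /PQS /orP[].
Qed.

Lemma pr_mono (P Q : pred T) : (forall t, P t -> Q t) -> pr P <= pr Q.
Proof. exact: mu_mono. Qed.

Lemma pr_meet (P Q : pred T) : 1 < pr P + pr Q -> exists t, P t && Q t.
Proof.
move=> gt1; apply: contrapT => disj.
suff : pr P + pr Q <= 1 by rewrite leNgt gt1.
rewrite -mu_setT /pr -muU; last first.
  rewrite predeqE => t; split=> // -[/= Pt Qt].
  by apply: disj; exists t; rewrite Pt Qt.
exact: mu_mono.
Qed.

(** Stands in for integrating a simple function: splitting [B] along [P i] lowers the bound to
    [K - w i] where [P i] holds. Localizing to [B] lets the induction pass. *)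
Lemma mean_le_on (I : Type) (s : seq I) (w : I -> R) (P : I -> pred T)
    (K : R) (B : set T) :
  (forall t, B t -> \sum_(i <- s) w i * (P i t)%:R <= K) ->
  \sum_(i <- s) w i * mu (B `&` [set t | P i t]) <= K * mu B.
Proof.
elim: s K B => [|i s IHs] K B; rewrite ?big_nil ?big_cons => sumB.
  (* Only a point of [B] shows [0 <= K]; an empty [B] has measure 0. *)
  have [->|/set0P[t /sumB]] := eqVneq B set0; first by rewrite mu_set0 mulr0.
  by rewrite big_nil => K_ge0; rewrite mulr_ge0.
set A := [set t | P i t].
have IHin : \sum_(j <- s) w j * mu (B `&` A `&` [set t | P j t])
    <= (K - w i) * mu (B `&` A).
  apply: IHs => t [/sumB]; rewrite big_cons /A/= => + Pt.
  by rewrite Pt mulr1 lerBrDl.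
have IHout : \sum_(j <- s) w j * mu ((B `\` A) `&` [set t | P j t])
    <= K * mu (B `\` A).
  apply: IHs => t [/sumB]; rewrite big_cons /A/= => + /negP/negPf Pt.
  by rewrite Pt mulr0 add0r.
have -> : \sum_(j <- s) w j * mu (B `&` [set t | P j t]) =
    \sum_(j <- s) w j * mu (B `&` A `&` [set t | P j t]) +
    \sum_(j <- s) w j * mu ((B `\` A) `&` [set t | P j t]).
  rewrite -big_split/=; apply: eq_bigr => j _; rewrite -mulrDr; congr (_ * _).
  by rewrite (mu_split A (B `&` _)) setIAC setIDAC [_ `&` (_ `\` _)]setIDA.
rewrite (mu_split A B); lra.
Qed.

Lemma mean_le (I : finType) (w : I -> R) (P : I -> pred T) (K : R) :
  (forall t, \sum_i w i * (P i t)%:R <= K) -> \sum_i w i * pr (P i) <= K.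
Proof.
move=> sumK.
have := @mean_le_on _ (index_enum I) w P K [set: T] (fun t _ => sumK t).
by rewrite mu_setT mulr1; under eq_bigr do rewrite setTI.
Qed.

Lemma mean_eq (I : finType) (w : I -> R) (P : I -> pred T) (K : R) :
  (forall t, \sum_i w i * (P i t)%:R = K) -> \sum_i w i * pr (P i) = K.
Proof.
move=> sumK; apply/eqP; rewrite eq_le mean_le/=; last by move=> t; rewrite sumK.
(* The weights may have any sign, so the reverse bound is [mean_le] for [- w] and [- K]. *)
rewrite -lerN2 -sumrN; under eq_bigr do rewrite -mulNr.
by apply: mean_le => t; under eq_bigr do rewrite mulNr; rewrite sumrN sumK.
Qed.

Lemma mean_card_le (I : finType) (P : I -> pred T) (K : R) :
  (forall t, #|[set i | P i t]%SET|%:R <= K) -> \sum_i pr (P i) <= K.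
Proof.
move=> cardK; under eq_bigr do rewrite -[pr _]mul1r.
apply: mean_le => t; apply: le_trans (cardK t).
rewrite -sum1_card natr_sum [leRHS]big_mkcond/=; apply: ler_sum => i _.
by rewrite inE mul1r; case: (P i t).
Qed.

Lemma pr_additive (P Q : pred T) :
  (forall t, ~~ (P t && Q t)) -> pr (fun t => P t || Q t) = pr P + pr Q.
Proof.
move=> disj; rewrite /pr -muU.
  by congr mu; rewrite predeqE => t; split=> /orP.
by rewrite predeqE => t; split=> // -[/= Pt Qt]; have := disj t; rewrite Pt Qt.
Qed.

Lemma pr_predC (P : pred T) : pr (predC P) = 1 - pr P.
Proof.
have /pr_additive : forall t, ~~ (P t && predC P t) by move=> t; rewrite andbN.
by rewrite pr_full => [|t]; [lra | exact: orbN].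
Qed.

End FinitelyAdditiveProbability.

(** * Equivalence relations with boundedly many classes *)

Lemma finite_quotient (P : Type) (e : P -> P -> Prop) (M : nat) :
  (forall p, e p p) -> (forall p q, e p q -> e q p) ->
  (forall p q r, e p q -> e q r -> e p r) ->
  (forall m (r : 'I_m -> P),
     (forall i j, e (r i) (r j) -> i = j) -> (m <= M)%N) ->
  exists m (r : 'I_m -> P) (cls : P -> 'I_m),
    [/\ forall p, e p (r (cls p)), cancel r cls
      & forall p q, e p q -> cls p = cls q].
Proof.
move=> e_refl e_sym e_trans bound.
pose indep m := `[< exists r : 'I_m -> P, forall i j, e (r i) (r j) -> i = j >].
have ex_indep : exists m, indep m.
  have r0 : 'I_0 -> P by case.
  by exists 0%N; apply/asboolP; exists r0; case.
have ub_indep m : indep m -> (m <= M)%N by move=> /asboolP[r]; apply: bound.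
have [m /asboolP[r r_indep] m_max] := ex_maxnP ex_indep ub_indep.
(* A largest family of pairwise inequivalent points meets every class: a missed point would extend
   it, at index [ord_max]. *)
have : forall p, exists i, e p (r i).
  move=> p; apply: contrapT => /forallNP no_rep.
  suff /m_max : indep m.+1 by rewrite ltnn.
  apply/asboolP; exists (fun i => oapp r p (unlift ord_max i)) => i j.
  case: unliftP => [i' ->|->]; case: unliftP => [j' ->|->] //=.
  - by move=> /r_indep ->.
  - by move=> /e_sym /no_rep.
  - by move=> /no_rep.
move=> /choice[cls e_cls]; exists m, r, cls; split=> // [i|p q pq].
  by apply/esym/r_indep.
by apply/r_indep/(e_trans _ p); [apply: e_sym | apply: (e_trans _ q)].
Qed.

(** * Visiting frequencies in a finite action *)

Section FiniteAction.
Context (R : realType) (Gamma : groupType) (mu : set Gamma -> R).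
Hypothesis mu_ge0 : forall A, 0 <= mu A.
Hypothesis mu_setT : mu [set: Gamma] = 1.
Hypothesis muU :
  forall A B, (A `&` B = set0)%classic -> mu (A `|` B)%classic = mu A + mu B.
Hypothesis mu_left :
  forall (g : Gamma) A, mu [set (g * x)%g | x in A]%classic = mu A.

Let pr (P : pred Gamma) := mu [set x | P x]%classic.

Lemma pr_shift (g : Gamma) (P : pred Gamma) :
  pr (fun x => P (g^-1 * x)%g) = pr P.
Proof.
rewrite -[RHS](mu_left g); congr mu; rewrite predeqE => x; split=> /= [Px|].
  by exists (g^-1 * x)%g; rewrite // mulVKg.
by case=> y Py <-; rewrite mulKg.
Qed.

Context (X : finType) (act : Gamma -> X -> X).
Hypothesis act1 : forall x, act 1%g x = x.
Hypothesis actM : forall g h x, act (g * h)%g x = act g (act h x).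

(** The proportion of the orbit of [x] lying in [U], as a mean over the group; the inverse makes
    left invariance of [mu] applicable. *)
Definition visits (U : {set X}) (x : X) : R := pr (fun g => act g^-1%g x \in U).

Lemma visits_act U g x : visits U (act g x) = visits U x.
Proof.
rewrite /visits -[RHS](pr_shift g); congr mu; apply: eq_set => y /=.
by rewrite -actM invgM invgK.
Qed.

(** For each fixed [g], reindexing by the bijection [act g], which preserves [b], already gives the
    right-hand side; then average over [g]. *)
Lemma sum_visits (b : X -> R) (U : {set X}) :
  (forall g x, b (act g x) = b x) ->
  \sum_x b x * visits U x = \sum_(x in U) b x.
Proof.
move=> b_inv; apply: mean_eq => // g.
rewrite [RHS]big_mkcond (reindex (act g))/=; last first.
  by exists (act g^-1%g) => x _; rewrite -actM ?mulVg ?mulgV act1.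
apply: eq_bigr => x _; rewrite -actM mulVg act1 b_inv.
by case: (x \in U); rewrite ?mulr1 ?mulr0.
Qed.

Lemma visitsC U x : visits (~: U) x = 1 - visits U x.
Proof.
rewrite /visits -pr_predC//; congr mu; apply: eq_set => g /=.
by rewrite finset.inE.
Qed.

Lemma visitsD (U V : {set X}) x :
  V \subset U -> visits (U :\: V) x = visits U x - visits V x.
Proof.
move=> VU; apply/eqP; rewrite eq_sym subr_eq eq_sym -pr_additive//.
  apply/eqP; congr mu; apply: eq_set => g; rewrite finset.inE.
  by case: (boolP (_ \in V)) => [/(fintype.subsetP VU) ->|_] /=; rewrite ?orbF.
by move=> g; rewrite finset.inE; case: (_ \in V); rewrite ?andbF.
Qed.

(* [visits _ x] is constant on orbits. Orbits that visit [V] often are charged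
   to the points of [V] they contain, the others to their points in [A :\: V]. *)
Lemma card_setC_visits (A V : {set X}) :
  V \subset A -> (forall x, 1/2 < visits A x) ->
  #|~: A|%:R <= 4 * (\sum_(x in V) (1 - visits A x)) + 2 * #|A :\: V|%:R.
Proof.
move=> VA A_half.
rewrite -[X in X%:R <= _]sum1_card -[X in _ + 2 * X%:R]sum1_card !natr_sum.
rewrite -!sum_visits//; last by move=> g x; rewrite visits_act.
rewrite !mulr_sumr -big_split/=; apply: ler_sum => x _.
have := A_half x; have := visitsD x VA; rewrite visitsC !mul1r => eqD half.
have V_ge0 : 0 <= visits V x by apply: mu_ge0.
have D_ge0 : 0 <= visits (A :\: V) x by apply: mu_ge0.
have A_le1 : visits A x <= 1 by rewrite /visits/pr -mu_setT mu_mono.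
(* With a, v the frequencies of [A], [V]: if v <= 1/4, then 2(a - v) > 1/2 > 1 - a; otherwise 4(1 -
   a)v >= 1 - a. *)
have [V_small|V_large] := leP (visits V x) (1/4).
  have : 0 <= (1 - visits A x) * visits V x by rewrite mulr_ge0// subr_ge0.
  by lra.
have : 0 <= (1 - visits A x) * (visits V x - 1/4).
  by rewrite mulr_ge0// subr_ge0// ltW.
by lra.
Qed.

End FiniteAction.

(** * The isometric action on translates *)

Section ApproximateAction.
Context (R : realType) (Gamma : groupType) (mu : set Gamma -> R).
Hypothesis mu_ge0 : forall A, 0 <= mu A.
Hypothesis mu_setT : mu [set: Gamma] = 1.
Hypothesis muU :
  forall A B, (A `&` B = set0)%classic -> mu (A `|` B)%classic = mu A + mu B.
Hypothesis mu_left :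
  forall (g : Gamma) A, mu [set (g * x)%g | x in A]%classic = mu A.
Context (n : nat) (f : Gamma -> 'S_n) (c : R).
Hypothesis f_almost_morph :
  forall g h : Gamma, #|[set i | f (g * h)%g i != f g (f h i)]%SET|%:R <= c.

Let pr (P : pred Gamma) := mu [set x | P x]%classic.

Definition shift (g : Gamma) (p : Gamma * 'I_n) : Gamma * 'I_n :=
  ((g * p.1)%g, p.2).

Lemma shiftM g h p : shift (g * h) p = shift g (shift h p).
Proof. by rewrite /shift mulgA. Qed.

Lemma shift1 p : shift 1 p = p.
Proof. by case: p => g i; rewrite /shift mul1g. Qed.

Definition base (i : 'I_n) : Gamma * 'I_n := (1%g, i).

(* The point [(g, i)] stands for the translate by [g] of the function
   [x |-> f (x^-1) i], and [dist] is the normalized Hamming distance. *)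
Definition dist (p q : Gamma * 'I_n) : R :=
  pr (fun x => f (x^-1 * p.1)%g p.2 != f (x^-1 * q.1)%g q.2).

Lemma dist_refl p : dist p p = 0.
Proof. by apply: pr_empty => // x; rewrite eqxx. Qed.

Lemma dist_sym p q : dist p q = dist q p.
Proof. by congr mu; apply: eq_set => x; rewrite eq_sym. Qed.

Lemma dist_triangle q p r : dist p r <= dist p q + dist q r.
Proof.
apply: pr_sub => // x; rewrite -negb_and; apply: contra => /andP[/eqP ->].
exact.
Qed.

Lemma dist_shift g p q : dist (shift g p) (shift g q) = dist p q.
Proof.
rewrite /dist -[RHS](pr_shift mu_left g); congr mu; apply: eq_set => x /=.
by rewrite invgM invgK !mulgA.
Qed.

Lemma dist_base i j : i != j -> dist (base i) (base j) = 1.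
Proof. by move=> ij; apply: pr_full => // x; rewrite (inj_eq perm_inj). Qed.

(** At each [x], the indices where the two functions differ are those counted by [f_almost_morph]
    for the pair [x^-1], [g]. *)
Lemma dist_base_mean g : \sum_i dist (shift g (base i)) (base (f g i)) <= c.
Proof.
apply: mean_card_le => // x; apply: le_trans (f_almost_morph x^-1 g).
by under eq_finset do rewrite /= !mulg1.
Qed.

(** Markov's inequality for [dist_base_mean]. *)
Lemma dist_base_far g e : 0 < e ->
  #|[set i | e <= dist (shift g (base i)) (base (f g i))]%SET|%:R <= e^-1 * c.
Proof.
move=> e_gt0; rewrite ler_pdivlMl//; apply: le_trans (dist_base_mean g).
rewrite -sum1_card natr_sum mulr_sumr big_mkcond/=; apply: ler_sum => i _.
by rewrite inE mulr1; case: ifP => // _; apply: mu_ge0.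
Qed.

(** * Near points and the distance gap *)

Definition near p : bool := [exists k, dist p (base k) < 1/6].

Definition occ p : R := pr (fun g => near (shift g^-1 p)).

Lemma occ_shift g p : occ (shift g p) = occ p.
Proof.
rewrite /occ -[RHS](pr_shift mu_left g); congr mu; apply: eq_set => x /=.
by rewrite -shiftM invgM invgK.
Qed.

(** The path from [base k] through [p] and [q] to [base l] is shorter than 1/6 + 2/3 + 1/6 = 1, the
    distance of distinct base points. *)
Lemma near_inj p q k l : dist p q < 2/3 ->
  dist p (base k) < 1/6 -> dist q (base l) < 1/6 -> k = l.
Proof.
move=> pq pk ql; apply/eqP; apply: contraT => /dist_base kl.
have := dist_triangle p (base k) (base l).
have := dist_triangle q p (base l).
by rewrite (dist_sym (base k) p); lra.
Qed.

Lemma near_close p q k :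
  dist p (base k) < 1/6 -> dist q (base k) < 1/6 -> dist p q < 1/3.
Proof.
move=> pk qk; have := dist_triangle (base k) p q.
by rewrite (dist_sym (base k)); lra.
Qed.

(** Makes closeness transitive: two distances below 1/3 add up to less than 2/3. *)
Lemma dist_gap p q :
  1/2 < occ p -> 1/2 < occ q -> dist p q < 2/3 -> dist p q < 1/3.
Proof.
move=> p_good q_good pq.
have /(pr_meet mu_ge0 mu_setT muU)[g] : 1 < occ p + occ q by lra.
rewrite -(dist_shift g^-1) in pq *.
case/andP=> /existsP[k pk] /existsP[l ql].
by apply: (near_close pk); rewrite (near_inj pq pk ql).
Qed.

(** For each [g], a translate of [base i] by [g^-1] that is not near is at least 1/6 away from
    [base (f g^-1 i)]; Markov allows this for at most [6 * c] indices. *)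
Lemma sum_occ_base : \sum_i (1 - occ (base i)) <= 6 * c.
Proof.
under eq_bigr do rewrite -pr_predC//.
apply: mean_card_le => // g.
apply: le_trans (_ : (1/6)^-1 * c <= _); last by rewrite invf_div divr1.
apply: le_trans (dist_base_far g^-1 _); last by lra.
rewrite ler_nat; apply/subset_leq_card/fintype.subsetP => i; rewrite !inE.
by rewrite leNgt; apply: contra => close; apply/existsP; exists (f g^-1 i).
Qed.

Definition bad : {set 'I_n} := [set i | occ (base i) <= 1/2]%SET.

Lemma card_bad : #|bad|%:R <= 12 * c.
Proof.
suff : (1/2) * #|bad|%:R <= 6 * c by lra.
apply: le_trans sum_occ_base.
rewrite -sum1_card natr_sum mulr_sumr big_mkcond/=; apply: ler_sum => i _.
rewrite inE mulr1; case: ifP => [|_]; first by lra.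
by rewrite subr_ge0 -mu_setT mu_mono.
Qed.


(** Two of the points within 1/6 of the same base point are within 1/3 of each other, hence have
    equal index. So [closest] recovers each near index from one of [n] base points. *)
Lemma card_near (I : finType) (p : I -> Gamma * 'I_n) :
  (forall i j, dist (p i) (p j) < 1/3 -> i = j) ->
  (#|[set i | near (p i)]%SET| <= n)%N.
Proof.
move=> p_sep; rewrite -(card_imset _ (@Some_inj _ : injective (@Some I))).
rewrite -[leqRHS]card_ord.
pose closest k := [pick i | dist (p i) (base k) < 1/6].
apply: leq_trans (leq_imset_card closest _).
apply/subset_leq_card/fintype.subsetP => _ /imsetP[i i_near ->].
move: i_near; rewrite finset.inE => /existsP[k ik].
apply/imsetP; exists k => //.
rewrite /closest; case: pickP => [j jk|/(_ i)]; last by rewrite ik.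
by congr Some; apply/p_sep/(near_close ik jk).
Qed.

(** By [occ_shift] these are exactly the translates of the base points outside [bad]. *)
Let good := {p | 1/2 < occ p}.

Let close (p q : good) : Prop := dist (val p) (val q) < 1/3.

Let shift_good g (p : good) : good :=
  exist _ (shift g (val p))
    (eq_ind_r (fun r => 1/2 < r) (valP p) (occ_shift g (val p))).

(** Each [r i] is near for more than half of the translations, but each translation leaves at most
    [n] of them near. This crude bound only serves to make the quotient finite. *)
Lemma card_separated m (r : 'I_m -> good) :
  (forall i j, close (r i) (r j) -> i = j) -> (m <= n.*2)%N.
Proof.
move=> r_sep; suff : m%:R * (1/2) <= n%:R :> R.
  by rewrite -(ler_nat R) -muln2 natrM; lra.
apply: le_trans (_ : \sum_i occ (val (r i)) <= _).
  rewrite -[m in m%:R]card_ord -sum1_card natr_sum mulr_suml.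
  by apply: ler_sum => i _; rewrite [leLHS]mul1r; apply/ltW/(valP (r i)).
apply: mean_card_le => // g; rewrite ler_nat; apply: card_near => i j.
by rewrite dist_shift; apply: r_sep.
Qed.

(** * The finite quotient and its action *)

Lemma exists_action :
  exists (X : finType) (act : Gamma -> X -> X) (iota : 'I_n -> X),
    [/\ forall x, act 1%g x = x,
        forall g h x, act (g * h)%g x = act g (act h x),
        injective iota,
        #|X|%:R <= n%:R + 60 * c
      & forall g, #|[set i | iota (f g i) != act g (iota i)]%SET|%:R <= 27 * c].
Proof.
have close_refl p : close p p by rewrite /close dist_refl; lra.
have close_sym p q : close p q -> close q p by rewrite /close dist_sym.
have close_trans p q r : close p q -> close q r -> close p r.
  rewrite /close => pq qr; apply: dist_gap (valP p) (valP r) _.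
  by have := dist_triangle (val q) (val p) (val r); lra.
have [m [r [cls [close_cls r_cls clsP]]]] :=
  finite_quotient close_refl close_sym close_trans card_separated.
have cls_close p q : cls p = cls q -> close p q.
  move=> pq; apply: close_trans (close_cls p) _.
  by rewrite pq; apply/close_sym/close_cls.
pose actI g i := cls (shift_good g (r i)).
have actIE g p : actI g (cls p) = cls (shift_good g p).
  by apply: clsP; rewrite /close/= dist_shift; apply/close_sym/close_cls.
have actI1 i : actI 1%g i = i.
  by rewrite -[RHS]r_cls; congr cls; apply/val_inj/shift1.
have actIM g h i : actI (g * h)%g i = actI g (actI h i).
  by rewrite [actI h i]/actI actIE; congr cls; apply/val_inj/shiftM.
have not_bad i : i \notin bad -> 1/2 < occ (base i).
  by rewrite finset.inE -ltNge.
pose J := {i : 'I_n | i \notin bad}; pose B := {i : 'I_n | i \in bad}.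
pose good_base (j : J) : good := exist _ (base (val j)) (not_bad _ (valP j)).
have base_inj i j : dist (base i) (base j) < 1/3 -> i = j.
  by move=> ij; apply/eqP; apply: contraT => /dist_base; lra.
have cls_inj : injective (cls \o good_base).
  by move=> i j /cls_close /base_inj /val_inj.
pose A := [set i | `[< exists p, cls p = i /\ near (val p) >]]%SET.
pose V := [set cls (good_base j) | j : J]%SET.
have cardA : (#|A| <= n)%N.
  (* One representative per class, near whenever the class has a near member; distinct classes are
     separated, so [card_near] applies. *)
  have /choice[p pP] i : exists p, cls p = i /\ (i \in A -> near (val p)).
    have [|iNA] := boolP (i \in A); last by exists (r i).
    by rewrite finset.inE => /asboolP[p [<- p_near]]; exists p.
  apply: leq_trans (card_near (p := val \o p) _) => [|i j /= /clsP].
    apply/subset_leq_card/fintype.subsetP => i iA; rewrite finset.inE /=.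
    by case: (pP i) => _; apply.
  by case: (pP i) => ->; case: (pP j) => ->.
have VA : V \subset A.
  apply/fintype.subsetP => _ /imsetP[j _ ->]; rewrite finset.inE.
  apply/asboolP; exists (good_base j); split=> //.
  by apply/existsP; exists (val j); rewrite dist_refl; lra.
have cardV : (#|V| + #|bad| = n)%N.
  rewrite card_imset// card_sig -[RHS]card_ord -(cardC (mem bad)) addnC.
  by congr addn; apply: eq_card => i; rewrite inE.
(* A class lies in [A] as soon as one member is near, so it visits [A] at least as often as [p] is
   near. *)
have occ_visits p : occ (val p) <= visits mu actI A (cls p).
  apply: pr_mono => // g p_near; rewrite finset.inE actIE.
  by apply/asboolP; exists (shift_good g^-1%g p).
have A_half i : 1/2 < visits mu actI A i.
  by rewrite -(r_cls i); apply: lt_le_trans (valP (r i)) (occ_visits _).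
have sumV : \sum_(i in V) (1 - visits mu actI A i) <= 6 * c.
  rewrite big_imset/=; last by move=> i j _ _; apply: cls_inj.
  apply: le_trans (_ : \sum_(j : J) (1 - occ (base (val j))) <= _).
    by apply: ler_sum => j _; rewrite lerD2l lerN2 (occ_visits (good_base j)).
  rewrite -(big_imset (fun i => 1 - occ (base i)))/=; last first.
    by move=> i j _ _; apply: val_inj.
  apply: le_trans sum_occ_base; rewrite big_mkcond/=; apply: ler_sum => i _.
  by case: ifP => // _; rewrite subr_ge0 -mu_setT mu_mono.
(* Since [#|A| <= n] and [#|V| = n - #|bad|], at most 12c points lie in [A :\: V]; the complement of
   [A] has at most 4 * 6c + 2 * 12c = 48c. *)
have cardI : m%:R <= n%:R + 48 * c.
  have := card_setC_visits mu_ge0 mu_setT muU mu_left actI1 actIM VA A_half.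
  have eqm : m%:R = #|A|%:R + #|~: A|%:R :> R.
    by rewrite -natrD finset.cardsC card_ord.
  have eqA : #|A|%:R = #|V|%:R + #|A :\: V|%:R :> R.
    by rewrite -natrD -[in LHS](cardsID V A) (finset.setIidPr VA).
  have eqn : #|V|%:R + #|bad|%:R = n%:R :> R by rewrite -natrD cardV.
  have := card_bad; move: cardA; rewrite -(ler_nat R); move: sumV; lra.
pose X := ('I_m + B)%type.
pose act g (x : X) := if x is inl i then inl (actI g i) else x.
have /choice[iota iotaP] (i : 'I_n) : exists x : X,
    (exists2 j, val j = i & x = inl (cls (good_base j))) \/
    (exists2 b : B, val b = i & x = inr b).
  have [i_bad|i_good] := boolP (i \in bad).
    by exists (inr (exist _ i i_bad)); right; exists (exist _ i i_bad).
  by eexists; left; exists (exist _ i i_good).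
exists X, act, iota; split.
- by case=> //= i; rewrite actI1.
- by move=> g h [] //= i; rewrite actIM.
- move=> i i'; case: (iotaP i) => -[j <- ->];
    case: (iotaP i') => -[j' <- ->] //.
    by move=> [/cls_inj ->].
  by move=> [->].
(* The 48c extra classes and at most 12c fixed points give 60c. *)
- rewrite card_sum card_ord card_sig natrD.
  rewrite (eq_card (_ : _ =i bad)) => [|i]; last by rewrite inE.
  have := card_bad; lra.
move=> g.
(* Mismatches need [i] bad, [f g i] bad, or [i] in [far]: 12c + 12c + 3c = 27c. *)
pose far :=
  [set i | (1/3 : R) <= dist (shift g (base i)) (base (f g i))]%SET.
have far_card : #|far|%:R <= 3 * c.
  have : (0 : R) < 1/3 by lra.
  by move=> /(dist_base_far g); rewrite invf_div divr1.
apply: le_trans (_ : #|bad :|: (f g @^-1: bad) :|: far|%SET%:R <= _).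
  rewrite ler_nat; apply/subset_leq_card/fintype.subsetP => i.
  rewrite finset.inE !finset.in_setU [i \in f g @^-1: _]finset.inE.
  apply: contraR.
  rewrite !negb_or => /andP[/andP[i_good fi_good]].
  rewrite finset.inE -ltNge => i_near.
  case: (iotaP i) => -[[j jP] /= ji ->]; last by rewrite -ji jP in i_good.
  case: (iotaP (f g i)) => -[[k kP] /= ki ->];
    last by rewrite -ki kP in fi_good.
  rewrite actIE; apply/eqP; congr inl; apply/clsP/close_sym.
  by rewrite /close /= ji ki.
have := card_bad.
have := leq_of_leqif (leq_card_setU (bad :|: (f g @^-1: bad)) far).
have := leq_of_leqif (leq_card_setU bad (f g @^-1: bad)).
rewrite card_preimset; last exact: perm_inj.
rewrite -!(ler_nat R) !natrD; lra.
Qed.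

End ApproximateAction.

(** * From a finite action to a homomorphism into permutations *)

Lemma injection_widen_ord (X : finType) (n : nat) (iota : 'I_n -> X) :
  injective iota ->
  exists (le_nX : (n <= #|X|)%N) (e : X -> 'I_#|X|),
    bijective e /\ forall i, e (iota i) = widen_ord le_nX i.
Proof.
move=> iota_inj; have le_nX : (n <= #|X|)%N.
  by rewrite -[leqLHS]card_ord -(card_codom iota_inj) max_card.
(* Points are numbered by position in a list that begins with the values of [iota] in order, so
   [iota] becomes [widen_ord]. *)
pose s := codom iota ++ [seq x <- enum X | x \notin codom iota].
have s_all x : x \in s.
  by rewrite mem_cat mem_filter mem_enum andbT orbN.
have s_uniq : uniq s.
  rewrite cat_uniq map_inj_uniq// enum_uniq filter_uniq ?enum_uniq// andbT.
  by apply/hasPn => x; rewrite mem_filter => /andP[].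
have size_s : size s = #|X|.
  by rewrite -(card_uniqP s_uniq); apply: eq_card.
have idx_lt x : (index x s < #|X|)%N by rewrite -size_s index_mem.
exists le_nX, (fun x => Ordinal (idx_lt x)); split=> [|i].
  apply: inj_card_bij; last by rewrite card_ord.
  by move=> x y [eq_idx]; rewrite -(nth_index x (s_all x)) eq_idx nth_index.
apply: val_inj; rewrite /= index_cat codom_f.
by rewrite index_map// index_enum_ord.
Qed.

Lemma dH_le1 (R : realType) (n N : nat) (le_nN : (n <= N)%N) s t :
  dH R le_nN s t <= 1.
Proof.
rewrite /dH; case: N le_nN t => [|N] le_nN t; first by rewrite invr0 mulr0.
rewrite ler_pdivrMr ?ltr0n// mul1r ler_nat -[leqRHS](subnKC le_nN) leq_add2r.
by rewrite -[leqRHS]card_ord max_card.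
Qed.

Lemma card_def_infty (R : realType) (Gamma : groupType) (n : nat)
    (f : Gamma -> 'S_n) (n_ge1 : (1 <= n)%N) (g h : Gamma) :
  #|[set i | f (g * h)%g i != f g (f h i)]%SET|%:R <= def_infty R f * n%:R.
Proof.
rewrite -ler_pdivrMr ?ltr0n//.
have : dH R (leqnn n) (f (g * h)%g) (perm_comp (f g) (f h)) <= def_infty R f.
  apply: ub_le_sup; last by exists g, h.
  by exists 1 => _ [g1 [g2 ->]]; apply: dH_le1.
rewrite /dH subnn addn0; congr (_%:R / _ <= _); apply: eq_card => i.
have widen_id j : widen_ord (leqnn n) j = j by apply: val_inj.
by rewrite !finset.inE !widen_id /perm_comp permM.
Qed.

Theorem theorem1p2 (R : realType) (Gamma : groupType)
    (amenable_Gamma : amenable R Gamma)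
    (n : nat) (n_ge1 : (1 <= n)%N) (f : Gamma -> 'S_n) :
  exists (N : nat) (le_nN : (n <= N)%N) (h : Gamma -> 'S_N),
    [/\ perm_hom h,
        d_infty R le_nN f h <= 2039 * def_infty R f
      & N%:R <= (1 + 1218 * def_infty R f) * n%:R].
Proof.
case: amenable_Gamma => mu [mu_ge0 mu_setT muU mu_left].
set d := def_infty R f.
have [X [act [iota [act1 actM iota_inj cardX mismatch]]]] :=
  exists_action mu_ge0 mu_setT muU mu_left (card_def_infty R f n_ge1).
rewrite -/d in cardX mismatch.
have [le_nX [e [[e' eK e'K] e_iota]]] := injection_widen_ord iota_inj.
have act_inj g : injective (act g).
  by apply: (can_inj (g := act g^-1%g)) => x; rewrite -actM mulVg act1.
have h_inj g : injective (fun y => e (act g (e' y))).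
  by move=> x y /(can_inj eK) /act_inj /(can_inj e'K).
have d_ge0 : 0 <= d.
  have : 0 <= d * n%:R by apply: le_trans (card_def_infty R f n_ge1 1%g 1%g).
  by rewrite pmulr_lge0// ltr0n.
have dn_ge0 : 0 <= d * n%:R by rewrite mulr_ge0.
exists #|X|, le_nX, (fun g => perm (h_inj g)); split.
- move=> g1 g2; apply/permP => y.
  by rewrite /perm_comp permM !permE eK actM.
- apply: ge_sup => [|_ [g ->]]; first by eexists; exists 1%g.
  have X_gt0 : (0 < #|X|)%N by rewrite (leq_trans n_ge1).
  rewrite /dH ler_pdivrMr ?ltr0n// natrD natrB//.
  have -> : #|[set x | widen_ord le_nX (f g x)
                       != perm (h_inj g) (widen_ord le_nX x)]%SET|
      = #|[set i | iota (f g i) != act g (iota i)]%SET|.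
    apply: eq_card => i; rewrite !finset.inE permE -!e_iota eK.
    by rewrite (inj_eq (can_inj eK)).
  (* With c = dn, the numerator is at most 27c + 60c = 87dn, and [n <= #|X|] gives the bound 87d,
     below 2039d. *)
  have := mismatch g; have := le_nX; rewrite -(ler_nat R) => /(ler_wpM2l d_ge0).
  by lra.
- by lra.
Qed.
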